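(* Let $E$ be a normed space (over $\mathbb{R}$ or $\mathbb{C}$), let $[a,b]$ be a compact interval with $a<b$, let $1\le p\le q<+\infty$, and let $f\colon E\to E$ be a map. Then the composition operator $C_f$ generated by $f$ maps $BV_p([a,b],E)$ into $BV_q([a,b],E)$ (that is, $C_f(x)\in BV_q([a,b],E)$ for every $x\in BV_p([a,b],E)$) if and only if $f$ is Hölder continuous on precompact subsets of $E$ with exponent $p/q$.
   Context: $E$ is a normed space over the real or complex numbers with norm $\|\cdot\|_E$; it is not assumed complete. For $p\in[1,+\infty)$, a map $x\colon[a,b]\to E$ and a subinterval $[c,d]\subseteq[a,b]$, the $p$-variation (Wiener variation) of $x$ over $[c,d]$ is the possibly infinite quantity $$\operatorname{var}_p(x,[c,d])=\sup\sum_{i=1}^n\|x(t_i)-x(t_{i-1})\|_E^p,$$ where the supremum is over all finite partitions $c=t_0<t_1<\dots<t_n=d$ of $[c,d]$. $BV_p([a,b],E)$ denotes the set of all maps $x\colon[a,b]\to E$ with $\operatorname{var}_p(x,[a,b])<+\infty$. The composition operator $C_f$ generated by $f\colon E\to E$ assigns to a map $x\colon[a,b]\to E$ the map $C_f(x)\colon[a,b]\to E$ given by $C_f(x)(t)=f(x(t))$. A non-empty set $A\subseteq E$ is called precompact if every sequence of its elements contains a Cauchy subsequence (the limit need not exist in $E$). For $\alpha\in(0,1]$, a map $f\colon E\to E$ is Hölder continuous on precompact subsets of $E$ with exponent $\alpha$ if for every precompact set $K\subseteq E$ there exists a constant $L_K\ge0$ such that $\|f(u)-f(w)\|_E\le L_K\|u-w\|_E^\alpha$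 for all $u,w\in K$. *)

(* Defs.v *)
From mathcomp Require Import all_boot all_order all_algebra.
From mathcomp Require Import all_classical all_reals all_analysis.
From mathcomp.real_closed Require Import complex.

Set Implicit Arguments.
Unset Strict Implicit.
Unset Printing Implicit Defensive.

Import Order.TTheory GRing.Theory Num.Theory.
Import numFieldNormedType.Exports.

Local Open Scope classical_set_scope.
Local Open Scope ring_scope.

Variant scalar_kind := RealScalars | ComplexScalars.

Definition scalars (R : realType) (k : scalar_kind) : numFieldType :=
  match k with
  | RealScalars => R
  | ComplexScalars => R[i]
  end.

Definition scalar_re (R : realType) (k : scalar_kind) : scalars R k -> R :=
  match k with
  | RealScalars => id
  | ComplexScalars => @complex.Re R
  end.

(* The library norm takes its values in the scalar field. When the scalars are
   R[i] its values have zero imaginary part, so that taking the real part only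
   changes their type. *)
Definition rnorm (R : realType) (k : scalar_kind)
  (E : normedModType (scalars R k)) (u : E) : R := scalar_re `|u|.

(* A partition c = t_0 < t_1 < ... < t_n = d is encoded by the sequence
   s = [:: t_1; ...; t_n], as in [itv_partition]. *)
Definition pvar_sum (R : realType) (k : scalar_kind)
  (E : normedModType (scalars R k)) (p : R) (x : R -> E) (c d : R)
  (s : seq R) : R :=
  let t := nth d (c :: s) in
  \sum_(0 <= i < size s) (rnorm (x (t i.+1) - x (t i))) `^ p.

(* A map [a, b] -> E is encoded by a total function R -> E; only its values on
   [a, b] matter here, since partition points lie in [a, b]. *)
Definition pvar (R : realType) (k : scalar_kind)
  (E : normedModType (scalars R k)) (p : R) (x : R -> E) (c d : R) : \bar R :=
  ereal_sup [set (pvar_sum p x c d s)%:E | s in itv_partition c d].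

Definition BV (R : realType) (k : scalar_kind)
  (E : normedModType (scalars R k)) (p a b : R) : set (R -> E) :=
  [set x | (pvar p x a b < +oo)%E].

Definition comp_op (R : realType) (E : Type) (f : E -> E) (x : R -> E) :
  R -> E := fun t => f (x t).

(* This is weaker than the library's [precompact], which asks for the closure to
   be compact: limits of Cauchy subsequences need not exist in E. *)
Definition cauchy_precompact (R : realType) (k : scalar_kind)
  (E : normedModType (scalars R k)) (A : set E) : Prop :=
  A !=set0 /\
  forall u : nat -> E, (forall n, A (u n)) ->
    exists2 phi : nat -> nat, increasing_seq phi & cauchy ((u \o phi) @ \oo).

Definition hoelder_on_precompact (R : realType) (k : scalar_kind)
  (E : normedModType (scalars R k)) (alpha : R) (f : E -> E) : Prop :=
  forall K : set E, cauchy_precompact K ->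
    exists2 L : R, 0 <= L &
      forall u w, K u -> K w -> rnorm (f u - f w) <= L * rnorm (u - w) `^ alpha.

(* Main.v *)
Require Import Defs.
From mathcomp Require Import all_boot all_order all_algebra.
From mathcomp Require Import all_classical all_reals all_analysis.
From mathcomp.real_closed Require Import complex.
From mathcomp Require Import lra.

(** The proof rests on one reformulation of bounded p-variation
    ([BV_controlP]): [x] belongs to [BV_p] exactly when there is a real function
    [V] such that [|x t - x s|^p <= V t - V s] for [s <= t] in [[a, b]]. Such a
    control [V] (one may take the variation over [[a, t]]) is nondecreasing, and
    it replaces the supremum over partitions by a pointwise inequality.

    If [f] is Hölder on precompact sets, let [V] control [x] in [BV_p]. The range
    of [x] is precompact: [V] is bounded, so along any sequence of times the
    values of [V] have a convergent subsequence, along which [x] is Cauchy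
    ([precompact_range]). With [L] the Hölder constant of [f] on that range,
    [L^q V] controls [f o x] with exponent [q], because the exponent [p / q]
    turns the [q]-th power of an increment of [f o x] into the [p]-th power of
    one of [x].

    Conversely, suppose that [f] is not Hölder on a precompact set [K]. Then for
    every [e > 0] there are [u, w] in [K] and a count [m] with
    [m |w - u|^p <= e] and [m |f w - f u|^q >= 1]
    ([oscillation_of_not_hoelder]): going [m] times between [u] and [w] is cheap
    for the p-variation, but costs at least 1 after applying [f]. Choosing such
    pairs along a rapidly Cauchy sequence ([fast_oscillation]), one lets [x]
    spend infinitely many consecutive time blocks before [b], the [n]-th one
    oscillating between the [n]-th pair of points. The map [x] has finite
    p-variation since both the cost of the [n]-th block and the distance from it
    to any later one are at most [2^-n] ([zigzag_control]), whereas a control of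
    [f o x] would have to grow by 1 on each block ([zigzag_uncontrolled]). *)

Set Implicit Arguments.
Unset Strict Implicit.
Unset Printing Implicit Defensive.

Import Order.TTheory GRing.Theory Num.Theory.
Import numFieldNormedType.Exports.

Set Bullet Behavior "Strict Subproofs".

Local Open Scope classical_set_scope.
Local Open Scope ring_scope.

(** * Monotone powers and extractions *)

Lemma ler_powR_base (R : realType) (p x y : R) : 0 <= p -> 0 <= x -> x <= y ->
  x `^ p <= y `^ p.
Proof.
by move=> p0 x0 xy; rewrite ge0_ler_powR // nnegrE // (le_trans x0).
Qed.

Lemma leq_increasing_seq (phi : nat -> nat) : increasing_seq phi ->
  forall n, (n <= phi n)%N.
Proof.
move=> /increasing_seqP phiS; elim=> // n nphi.
exact: leq_ltn_trans nphi (phiS n).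
Qed.

(** * The real-valued norm *)

(** The section of [scalar_re] along which the library norm and [rnorm] agree
    ([rnormE]). Being additive and order-reflecting for both kinds of scalars, it
    transfers the norm axioms without repeating the case distinction. *)
Definition scalar_of_real (R : realType) (k : scalar_kind) :
    R -> scalars R k :=
  match k with
  | RealScalars => id
  | ComplexScalars => fun r => (r%:C)%C
  end.

Section scalar_of_real_theory.
Context {R : realType} {k : scalar_kind}.
Local Notation emb := (@scalar_of_real R k).

Lemma scalar_of_realD (x y : R) : emb (x + y) = emb x + emb y.
Proof. by rewrite /scalar_of_real; case: k => //; rewrite rmorphD. Qed.

Lemma le_scalar_of_real (x y : R) : (emb x <= emb y) = (x <= y).
Proof. by rewrite /scalar_of_real; case: k => //; rewrite lecR. Qed.

Lemma lt_scalar_of_real (x y : R) : (emb x < emb y) = (x < y).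
Proof. by rewrite /scalar_of_real; case: k => //; rewrite ltcR. Qed.

Lemma scalar_of_real0 : emb 0 = 0.
Proof. by rewrite /scalar_of_real; case: k. Qed.

Lemma scalar_reK (z : scalars R k) : 0 <= z -> emb (scalar_re z) = z.
Proof.
rewrite /scalar_of_real /scalar_re; case: k z => // -[x y].
by rewrite lecE /= => /andP[/eqP-> _].
Qed.

End scalar_of_real_theory.

Section rnorm_theory.
Context {R : realType} {k : scalar_kind} {E : normedModType (scalars R k)}.
Implicit Types u v w : E.

Lemma rnormE u : scalar_of_real k (rnorm u) = `|u|.
Proof. exact/scalar_reK/normr_ge0. Qed.

Lemma rnorm_ge0 u : 0 <= rnorm u.
Proof. by rewrite -(@le_scalar_of_real R k) rnormE scalar_of_real0. Qed.

Lemma rnorm0 : rnorm (0 : E) = 0.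
Proof. by rewrite /rnorm normr0 /scalar_re; case: k. Qed.

Lemma rnorm_eq0 u : rnorm u = 0 -> u = 0.
Proof. by move=> u0; apply: normr0_eq0; rewrite -rnormE u0 scalar_of_real0. Qed.

Lemma rdistC u v : rnorm (u - v) = rnorm (v - u).
Proof. by rewrite /rnorm distrC. Qed.

Lemma rdist_triangle w u v : rnorm (u - v) <= rnorm (u - w) + rnorm (w - v).
Proof.
by rewrite -(@le_scalar_of_real R k) scalar_of_realD !rnormE ler_distD.
Qed.

(** The uniform structure of [E] is indexed by scalar radii; this brings the
    Cauchy condition back to real ones. *)
Lemma cauchy_rnormP (u : nat -> E) :
  cauchy (u @ \oo) <->
  forall e : R, 0 < e -> exists N : nat, forall m n,
    (N <= m)%N -> (N <= n)%N -> rnorm (u m - u n) < e.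
Proof.
rewrite -cauchy_ballP; split=> [cu e e0|cu e e0].
- have /cu : 0 < @scalar_of_real R k e by rewrite -scalar_of_real0 lt_scalar_of_real.
  rewrite !near_map2 /= -ball_normE /= => -[[A B] /= [[M _ MA] [N _ NB]] AB].
  exists (maxn M N) => m n; rewrite !geq_max => /andP[Mm _] /andP[_ Nn].
  rewrite -(@lt_scalar_of_real R k) rnormE.
  by apply: (AB (m, n)); split => /=; [exact: MA|exact: NB].
- have ee := scalar_reK (ltW e0).
  have [|N uN] := cu (scalar_re e).
    by rewrite -(@lt_scalar_of_real R k) ee scalar_of_real0.
  rewrite !near_map2 /= -ball_normE /=.
  exists ([set m | (N <= m)%N], [set n | (N <= n)%N]) => /=; first by split; exists N.
  move=> [m n] /= [Nm Nn].
  by rewrite -rnormE -ee lt_scalar_of_real uN.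
Qed.

End rnorm_theory.

(** * Controls of the p-variation *)

Section control.
Context {R : realType} {k : scalar_kind} {E : normedModType (scalars R k)}.

Definition controls (p a b : R) (x : R -> E) (V : R -> R) :=
  forall s t, a <= s -> s <= t -> t <= b -> rnorm (x t - x s) `^ p <= V t - V s.

Lemma pvar_sum_rcons (p : R) (x : R -> E) (c d e : R) (s : seq R) :
  itv_partition c d s ->
  pvar_sum p x c e (rcons s e) = pvar_sum p x c d s + rnorm (x e - x d) `^ p.
Proof.
move=> cds; rewrite /pvar_sum size_rcons big_nat_recr //=; congr +%R.
  apply: eq_big_nat => i /andP[_ si].
  rewrite -!rcons_cons !nth_rcons /= si ltnS (ltnW si).
  rewrite (@set_nth_default _ s d e) //.
  by rewrite (@set_nth_default _ (c :: s) d e) //= ltnS ltnW.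
rewrite nth_rcons ltnn eqxx -rcons_cons nth_rcons /= ltnSn.
by rewrite (itv_partition_nth_size _ cds).
Qed.

Lemma pvar_ge0 (p : R) (x : R -> E) (a t : R) : a <= t -> (0 <= pvar p x a t)%E.
Proof.
move=> at_; have [s ats] : exists s, itv_partition a t s.
  move: at_; rewrite le_eqVlt => /predU1P[->|/itv_partition1]; last by exists [:: t].
  by exists [::]; split.
apply: (@le_trans _ _ (pvar_sum p x a t s)%:E).
  by rewrite lee_fin; apply: sumr_ge0 => i _; exact: powR_ge0.
by apply: ereal_sup_ubound; exists s.
Qed.

(** Appending [t] to a partition of [[a, s]] gives one of [[a, t]]. This is
    what makes [fun t => pvar p x a t] a control. The case [s = t], where nothing
    can be appended, is the one that needs [p != 0], so that [0 `^ p = 0]. *)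
Lemma pvar_superadditive (p a s t : R) (x : R -> E) : p != 0 ->
  a <= s -> s <= t ->
  (pvar p x a s + (rnorm (x t - x s) `^ p)%:E <= pvar p x a t)%E.
Proof.
move=> p0 as_; rewrite le_eqVlt => /predU1P[<-|st].
  by rewrite subrr rnorm0 powR0 // adde0.
rewrite -leeBrDr //; apply: ge_ereal_sup => _ [c cP <-].
rewrite leeBrDr // -EFinD -pvar_sum_rcons //.
apply: ereal_sup_ubound; exists (rcons c t) => //.
by rewrite -cats1; apply: itv_partition_cat cP _; exact: itv_partition1.
Qed.

(** In one direction the control is the variation over [[a, t]]; in the other,
    the increments of a control telescope along any partition. *)
Lemma BV_controlP (p a b : R) (x : R -> E) : p != 0 -> a <= b ->
  BV p a b x <-> exists V : R -> R, controls p a b x V.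
Proof.
move=> p0 ab; split=> [|[V xV]].
- rewrite /BV /= => xfin; exists (fun t => fine (pvar p x a t)).
  have pfin t : a <= t -> t <= b -> pvar p x a t \is a fin_num.
    move=> at_ tb; rewrite ge0_fin_numE ?pvar_ge0 //.
    apply: le_lt_trans xfin; apply: le_trans (pvar_superadditive x p0 at_ tb).
    by rewrite leeDl // lee_fin powR_ge0.
  move=> s t as_ st tb.
  rewrite lerBrDl -lee_fin EFinD !fineK ?pfin ?(le_trans as_ st) ?(le_trans st tb) //.
  exact: pvar_superadditive.
- apply: (@le_lt_trans _ _ (V b - V a)%:E); last exact: ltry.
  apply: ge_ereal_sup => _ [s abs <-]; rewrite lee_fin /pvar_sum.
  set t := nth b (a :: s).
  have -> : V b - V a = \sum_(0 <= i < size s) (V (t i.+1) - V (t i)).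
    by rewrite telescope_sumr // /t (itv_partition_nth_size _ abs).
  apply: ler_sum_nat => i /andP[_ si]; apply: xV.
  + by apply: itv_partition_nth_ge; rewrite // ltnW // ltnS.
  + apply: (@nondecreasing_fun_itv_partition _ _ _ _ id _ _ abs) => //.
  + by apply: itv_partition_nth_le; rewrite // ltnS.
Qed.

(** A control reduces the Cauchy property of [x] along a sequence of times to
    that of a bounded real sequence, to which Bolzano-Weierstrass applies. *)
Lemma precompact_range (p a b : R) (x : R -> E) : 0 < p -> a <= b ->
  BV p a b x -> cauchy_precompact (x @` `[a, b]).
Proof.
move=> p0 ab /(BV_controlP _ (lt0r_neq0 p0) ab) [V xV].
have Vnd s t : a <= s -> s <= t -> t <= b -> V s <= V t.
  by move=> as_ st tb; rewrite -subr_ge0 (le_trans _ (xV _ _ as_ st tb)) ?powR_ge0.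
split; first by exists (x a), a; rewrite //= in_itv /= lexx.
move=> u uK.
have /choice[t tP] : forall n, exists t, t \in `[a, b] /\ x t = u n.
  by move=> n; have [t tab <-] := uK n; exists t.
have at_ n : a <= t n by case: (tP n); rewrite in_itv /= => /andP[].
have tb n : t n <= b by case: (tP n); rewrite in_itv /= => /andP[].
have xVn m n : rnorm (u m - u n) `^ p <= `|V (t m) - V (t n)|.
  have [_ <-] := tP m; have [_ <-] := tP n.
  have [tmn|/ltW tnm] := leP (t m) (t n).
    by rewrite rdistC distrC (le_trans (xV _ _ _ tmn _)) // ler_norm.
  by rewrite (le_trans (xV _ _ _ tnm _)) // ler_norm.
have [|phi phiP cV] := @bolzano_weierstrass _ (V \o t).
  exists (`|V a| + `|V b|); split; first exact: num_real.
  move=> y /ltW My n _; apply: le_trans My.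
  have := Vnd _ _ (lexx a) (at_ n) (tb n); have := Vnd _ _ (at_ n) (tb n) (lexx b).
  rewrite /= ler_norml.
  have := ler_norm (V b); have := ler_norm (- V a); rewrite normrN.
  have := normr_ge0 (V a); have := normr_ge0 (V b).
  by lra.
exists phi => //; apply/cauchy_rnormP => e e0.
have /cvg_cauchy/cauchy_ballP := cV.
move=> /(_ (e `^ p)); rewrite powR_gt0 // => /(_ isT).
rewrite !near_map2 /= -ball_normE /= => -[[A B] /= [[M _ MA] [N _ NB]] AB].
exists (maxn M N) => m n; rewrite !geq_max => /andP[Mm _] /andP[_ Nn].
have {}AB := AB (m, n) (conj (MA _ Mm) (NB _ Nn)).
rewrite ltNge; apply/negP => /(ge0_ler_powR (ltW p0)).
rewrite !nnegrE rnorm_ge0 ltW // => /(_ isT isT).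
by apply/negP; rewrite -ltNge (le_lt_trans (xVn _ _)).
Qed.

End control.

(** * Hölder maps preserve bounded variation *)

Section sufficiency.
Context {R : realType} {k : scalar_kind} {E : normedModType (scalars R k)}.

Lemma comp_op_BV (p q a b : R) (f : E -> E) (x : R -> E) :
  0 < p -> 0 < q -> a <= b -> hoelder_on_precompact (p / q) f ->
  BV p a b x -> BV q a b (comp_op f x).
Proof.
move=> p0 q0 ab fH xBV.
have [L L0 fL] := fH _ (precompact_range p0 ab xBV).
have [V xV] := (BV_controlP _ (lt0r_neq0 p0) ab).1 xBV.
apply/(BV_controlP _ (lt0r_neq0 q0) ab); exists (fun t => L `^ q * V t).
move=> s t as_ st tb.
rewrite -mulrBr; apply: le_trans (ler_wpM2l (powR_ge0 _ _) (xV _ _ as_ st tb)).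
have xK r : a <= r -> r <= b -> (x @` `[a, b]) (x r).
  by move=> ar rb; exists r; rewrite //= in_itv /= ar.
have := fL _ _ (xK t (le_trans as_ st) tb) (xK s as_ (le_trans st tb)).
move/(ler_powR_base (ltW q0) (rnorm_ge0 _)); rewrite powRM ?powR_ge0 //.
by rewrite -powRrM divfK // gt_eqF.
Qed.

End sufficiency.

(** * Cheap oscillations of a non-Hölder map *)

Section oscillation.
Context {R : realType} {k : scalar_kind} {E : normedModType (scalars R k)}.

(** If [f] were unbounded on [K], a sequence of points with [|f v_n|] going to
    infinity would have a Cauchy subsequence; its tail stays within [d] of one of
    its points, so the values of [f] there stay within 1 of a fixed one. *)
Lemma bounded_oscillation_on_precompact (K : set E) (f : E -> E) (d : R) :
  cauchy_precompact K -> 0 < d ->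
  (forall u w, K u -> K w -> rnorm (u - w) <= d -> rnorm (f u - f w) <= 1) ->
  exists2 M : R, 0 <= M & forall u w, K u -> K w -> rnorm (f u - f w) <= M.
Proof.
move=> [[v0 Kv0] Kc] d0 fd.
suff [M fM] : exists M : R, forall v, K v -> rnorm (f v - f v0) <= M.
  have M0 : 0 <= M by apply: le_trans (fM _ Kv0); exact: rnorm_ge0.
  exists (M + M); first exact: addr_ge0.
  move=> u w Ku Kw; apply: le_trans (rdist_triangle (f v0) _ _) _.
  by apply: lerD; [|rewrite rdistC]; exact: fM.
apply: contrapT => /forallNP fub.
have /choice[v vP] : forall n : nat, exists v, K v /\ n%:R < rnorm (f v - f v0).
  move=> n; have /existsNP[v /not_implyP[Kv /negP]] := fub n%:R.
  by rewrite -ltNge; exists v.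
have [phi phiP /cauchy_rnormP/(_ d d0)[N vN]] := Kc v (fun n => (vP n).1).
set B := rnorm (f (v (phi N)) - f v0) + 1.
pose n := maxn N (Num.bound B).
have : rnorm (f (v (phi n)) - f v0) <= B.
  apply: le_trans (rdist_triangle (f (v (phi N))) _ _) _.
  rewrite addrC lerD2l; apply: fd; [exact: (vP _).1|exact: (vP _).1|].
  by apply/ltW/vN; rewrite ?leq_maxl.
apply/negP; rewrite -ltNge; apply: lt_trans (vP _).2.
apply: lt_le_trans (_ : (Num.bound B)%:R <= _).
  by rewrite archi_boundP // addr_ge0 ?rnorm_ge0.
by rewrite ler_nat (leq_trans _ (leq_increasing_seq phiP n)) // leq_maxr.
Qed.

(** If no such oscillation exists for some [e], then [f] is Hölder on [K]. Two
    points with [|u - w|^p <= e] can be visited [m = floor (e / |u - w|^p)] times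
    within the budget [e], so that [|f u - f w|^q < 1 / m], which is of order
    [|u - w|^p / e]. For more distant points the Hölder bound only says that
    [|f u - f w|] is bounded on [K]; this follows from the case [m = 1], in which
    [f] moves nearby points by at most 1. *)
Lemma oscillation_of_not_hoelder (p q : R) (f : E -> E) (K : set E) :
  0 < p -> 0 < q -> cauchy_precompact K ->
  ~ (exists2 L : R, 0 <= L & forall u w, K u -> K w ->
       rnorm (f u - f w) <= L * rnorm (u - w) `^ (p / q)) ->
  forall e : R, 0 < e -> exists u w : E, exists m : nat,
    [/\ K u, K w, m%:R * rnorm (w - u) `^ p <= e &
      1 <= m%:R * rnorm (f w - f u) `^ q].
Proof.
move=> p0 q0 Kc notH e e0; apply: contrapT => noosc; apply: notH.
have small u w (m : nat) : K u -> K w -> m%:R * rnorm (u - w) `^ p <= e ->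
    m%:R * rnorm (f u - f w) `^ q < 1.
  move=> Ku Kw muw; rewrite ltNge; apply/negP => mfuw.
  by apply: noosc; exists w, u, m.
have p1 : 0 <= p^-1 by rewrite invr_ge0 ltW.
have q1 : 0 <= q^-1 by rewrite invr_ge0 ltW.
have root1 : 1 `^ q^-1 = 1 :> R by rewrite powR1.
have root (s x y : R) : 0 < s -> 0 <= x -> x `^ s <= y -> x <= y `^ s^-1.
  move=> s0 x0 xy; rewrite -{1}(powRr1 x0) -(divff (lt0r_neq0 s0)) powRrM.
  by rewrite ler_powR_base ?powR_ge0 ?invr_ge0 // ltW.
have [M M0 fM] : exists2 M : R, 0 <= M &
    forall u w, K u -> K w -> rnorm (f u - f w) <= M.
  apply: (@bounded_oscillation_on_precompact K f (e `^ p^-1) Kc).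
    exact: powR_gt0.
  move=> u w Ku Kw uw; rewrite -root1; apply: root => //; first exact: rnorm_ge0.
  have := small u w 1%N Ku Kw; rewrite !mul1r => small1; apply/ltW/small1.
  apply: le_trans (ler_powR_base (ltW p0) (rnorm_ge0 _) uw) _.
  by rewrite -powRrM mulVf ?gt_eqF // powRr1 // ltW.
exists ((2 / e) `^ q^-1 + M * e^-1 `^ q^-1).
  by rewrite addr_ge0 ?mulr_ge0 ?powR_ge0.
move=> u w Ku Kw; set r := rnorm (u - w); set D := rnorm (f u - f w).
have r0 : 0 <= r := rnorm_ge0 _.
have D0 : 0 <= D := rnorm_ge0 _.
have [/rnorm_eq0/subr0_eq uw|/eqP rN0] := pselect (r = 0).
  by rewrite /D uw subrr rnorm0 !(mulr_ge0, addr_ge0, powR_ge0).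
have rp0 : 0 < r `^ p by rewrite powR_gt0 // lt_def rN0.
rewrite mulrDl powRrM.
have [rpe|/ltW epr] := leP (r `^ p) e.
  apply: ler_wpDr; first by rewrite !mulr_ge0 ?powR_ge0.
  rewrite -powRM ?powR_ge0 ?divr_ge0 ?(ltW e0) //; apply: root => //.
  (* Since [m >= 1], [e / r^p < m + 1 <= 2 m]: this is the 2 of the constant. *)
  pose m := Num.trunc (e / r `^ p).
  have /andP[mle ltm] := truncn_itv (divr_ge0 (ltW e0) (ltW rp0)).
  have m1 : 1 <= m%:R :> R.
    by rewrite ler1n /m truncn_gt0 ler_pdivlMr // mul1r.
  have mD : m%:R * D `^ q < 1 by apply: small => //; rewrite -ler_pdivlMr.
  rewrite -/m ltr_pdivrMr // -natr1 in ltm.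
  rewrite mulrAC ler_pdivlMr //.
  have Dq0 : 0 <= D `^ q := powR_ge0 _ _.
  apply: le_trans (ler_wpM2l Dq0 (ltW ltm)) _.
  rewrite mulrA ler_wpM2r ?(ltW rp0) //.
  by nra.
apply: ler_wpDl; first by rewrite !mulr_ge0 ?powR_ge0.
apply: le_trans (fM _ _ Ku Kw) _; rewrite -mulrA ler_peMr //.
rewrite -powRM ?powR_ge0 ?invr_ge0 ?(ltW e0) //.
by rewrite -root1 ler_powR_base // mulrC ler_pdivlMr // mul1r.
Qed.

(** The two points of the [n]-th pair are indexed by booleans. They are
    oscillations with the budget [(2^-n / 4)^p], which bounds the distance between
    the two points of a pair by [2^-n / 4] because the count [m] is at least 1;
    so extracting a Cauchy subsequence of the first points is enough. *)
Lemma fast_oscillation (p q : R) (f : E -> E) (K : set E) :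
  1 <= p -> cauchy_precompact K ->
  (forall e : R, 0 < e -> exists u w : E, exists m : nat,
    [/\ K u, K w, m%:R * rnorm (w - u) `^ p <= e &
      1 <= m%:R * rnorm (f w - f u) `^ q]) ->
  exists (y : nat -> bool -> E) (m : nat -> nat),
  [/\ forall n j b c, (n <= j)%N -> rnorm (y j c - y n b) <= 2^-1 ^+ n,
      forall n, (m n)%:R * rnorm (y n true - y n false) `^ p <= 2^-1 ^+ n &
      forall n, 1 <= (m n)%:R * rnorm (f (y n true) - f (y n false)) `^ q].
Proof.
move=> p1 [_ Kc] osc; pose h n : R := 2^-1 ^+ n / 4.
have h0 n : 0 < h n by rewrite divr_gt0 ?exprn_gt0 ?invr_gt0.
have hle i j : (i <= j)%N -> h j <= h i.
  by move=> ij; rewrite ler_pM2r ?invr_gt0 // ler_wiXn2l //; lra.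
have p0 : 0 < p by apply: lt_le_trans p1.
have /choice[c cP] : forall n, exists c : E * E * nat,
    [/\ K c.1.1, K c.1.2, c.2%:R * rnorm (c.1.2 - c.1.1) `^ p <= h n `^ p &
      1 <= c.2%:R * rnorm (f c.1.2 - f c.1.1) `^ q].
  move=> n; have [|u [w [m uwm]]] := osc (h n `^ p); first exact: powR_gt0.
  by exists (u, w, m).
pose u n := (c n).1.1; pose w n := (c n).1.2; pose m n := (c n).2.
have [phi phiP /cauchy_rnormP uphi] := Kc u (fun n => let: And4 H _ _ _ := cP n in H).
have /choice[N NP] := fun n => uphi (h n) (h0 n).
(* The sum puts [rank j] above all the [N n] with [n <= j] at once, and
   the summand [n] gives [n <= psi n]. *)
pose rank n := (n + \sum_(i < n.+1) N i)%N; pose psi n := phi (rank n).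
have psi_ge n : (n <= psi n)%N.
  by apply: leq_trans (leq_increasing_seq phiP _); exact: leq_addr.
have N_le n j : (n <= j)%N -> (N n <= rank j)%N.
  rewrite -ltnS => nj; rewrite /rank (bigD1 (Ordinal nj)) //=.
  by rewrite addnCA leq_addr.
have wu n : rnorm (w (psi n) - u (psi n)) <= h n.
  have [_ _ mp mq] := cP (psi n); apply: le_trans (hle _ _ (psi_ge n)).
  have m1 : 1 <= (m (psi n))%:R :> R.
    rewrite ler1n lt0n; apply/eqP => m0; move: mq; rewrite -/(m _) m0 mul0r.
    by rewrite ler10.
  rewrite leNgt; apply/negP => /(gt0_ltr_powR p0).
  rewrite !nnegrE rnorm_ge0 ltW // => /(_ isT isT).
  apply/negP; rewrite -leNgt; apply: le_trans mp.
  by rewrite ler_peMl ?powR_ge0.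
exists (fun n (b : bool) => if b then w (psi n) else u (psi n)), (m \o psi); split.
- move=> n j b b' nj.
  have yu i (d : bool) :
      rnorm ((if d then w (psi i) else u (psi i)) - u (psi i)) <= h i.
    by case: d; rewrite ?subrr ?rnorm0 ?(ltW (h0 _)).
  have ujn : rnorm (u (psi j) - u (psi n)) <= h n by apply/ltW/NP; exact: N_le.
  have := rdist_triangle (u (psi j)) (if b' then w (psi j) else u (psi j))
    (if b then w (psi n) else u (psi n)).
  have := rdist_triangle (u (psi n)) (u (psi j)) (if b then w (psi n) else u (psi n)).
  have := yu j b'; have := yu n b; have := hle _ _ nj; have := h0 n.
  rewrite [rnorm (u (psi n) - _)]rdistC.
  have -> : 2^-1 ^+ n = 4 * h n by rewrite /h mulrC divfK.
  lra.
- move=> n; have [_ _ mp _] := cP (psi n); apply: le_trans mp _.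
  have h1 : h (psi n) <= 1.
    by apply: le_trans (hle 0%N _ (leq0n _)) _; rewrite /h expr0; lra.
  apply: (@le_trans _ _ (h (psi n))).
    by rewrite ge1r_powR // h0 h1.
  apply: le_trans (hle _ _ (psi_ge n)) _.
  by have := h0 n; rewrite /h; lra.
- by move=> n; have [_ _ _ mq] := cP (psi n).
Qed.

End oscillation.

(** * The zigzag and its control *)

Section zigzag.
Context {R : realType} {k : scalar_kind} {E : normedModType (scalars R k)}.
Variables (y : nat -> bool -> E) (m : nat -> nat).

(** The time block [[n, n + 1[] is cut into [m n + 1] equal steps, numbered from
    0 to [m n], so that exactly [m n] oscillations occur inside the block. *)
Definition step (r : R) : nat :=
  let n := Num.trunc r in Num.trunc ((m n).+1%:R * (r - n%:R)).

(** The control of the zigzag. Inside a block it counts the oscillations made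
    so far, for a total of at most [2^-n]; from block [n] to a later one the
    second term rises by at least [2 * 2^-n], which pays both for resetting the
    counter and for the jump between the blocks, at most [2^-n] each. *)
Definition zigzag_potential (p r : R) : R :=
  let n := Num.trunc r in
  (step r)%:R * rnorm (y n true - y n false) `^ p - 4 * 2^-1 ^+ n.

Definition zigzag (r : R) : E := y (Num.trunc r) (odd (step r)).

Lemma step_le (r : R) : 0 <= r -> (step r <= m (Num.trunc r))%N.
Proof.
move=> r0; have /andP[nr rn] := truncn_itv r0.
rewrite -ltnS truncn_lt_nat ?mulr_ge0 ?subr_ge0 //.
by rewrite -[ltRHS]mulr1 ltr_pM2l // ltrBlDr addrC natr1.
Qed.

Lemma zigzag_control (p r s : R) : 1 <= p ->
  (forall n j b c, (n <= j)%N -> rnorm (y j c - y n b) <= 2^-1 ^+ n) ->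
  (forall n, (m n)%:R * rnorm (y n true - y n false) `^ p <= 2^-1 ^+ n) ->
  0 <= r -> r <= s ->
  rnorm (zigzag s - zigzag r) `^ p <= zigzag_potential p s - zigzag_potential p r.
Proof.
move=> p1 yclose msmall r0 rs; have s0 := le_trans r0 rs.
have p0 : 0 < p by apply: lt_le_trans p1.
rewrite /zigzag /zigzag_potential; set n := Num.trunc r; set j := Num.trunc s.
pose d i := rnorm (y i true - y i false); rewrite -!/(d _).
have nj : (n <= j)%N by exact: le_truncn.
have [nEj|njN] := eqVneq n j.
- rewrite -nEj opprB addrA subrK -mulrBl.
  have ij : (step r <= step s)%N.
    by rewrite /step -/n -/j -nEj le_truncn // ler_wpM2l // lerB.
  have [->|ijN] := eqVneq (step r) (step s).
    by rewrite !subrr mul0r rnorm0 powR0 // gt_eqF.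
  have yd b c : rnorm (y n b - y n c) `^ p <= d n `^ p.
    apply: ler_powR_base => //; [exact: ltW|exact: rnorm_ge0|].
    by case: b; case: c; rewrite ?subrr ?rnorm0 ?rnorm_ge0 //= rdistC.
  apply: le_trans (yd _ _) _; rewrite ler_peMl ?powR_ge0 //.
  by rewrite lerBrDr addrC natr1 ler_nat ltn_neqAle ijN.
- have nltj : (n < j)%N by rewrite ltn_neqAle njN.
  have hn0 : 0 < 2^-1 ^+ n :> R by rewrite exprn_gt0 // invr_gt0.
  have hn1 : 2^-1 ^+ n <= 1 :> R by rewrite exprn_ile1 //; lra.
  have hj : 2^-1 ^+ j <= 2^-1 * 2^-1 ^+ n :> R.
    by rewrite -exprS ler_wiXn2l //; lra.
  have jump : rnorm (y j (odd (step s)) - y n (odd (step r))) `^ p <= 2^-1 ^+ n.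
    apply: le_trans (ler_powR_base (ltW p0) (rnorm_ge0 _) (yclose _ _ _ _ nj)) _.
    by rewrite ge1r_powR // hn0.
  have inner : (step r)%:R * d n `^ p <= 2^-1 ^+ n.
    by apply: le_trans (msmall n); rewrite ler_wpM2r ?powR_ge0 // ler_nat step_le.
  have : 0 <= (step s)%:R * d j `^ p by rewrite mulr_ge0 ?powR_ge0.
  lra.
Qed.

Lemma zigzag_potential_le0 (p r : R) : 0 <= r ->
  (forall n, (m n)%:R * rnorm (y n true - y n false) `^ p <= 2^-1 ^+ n) ->
  zigzag_potential p r <= 0.
Proof.
move=> r0 msmall; rewrite /zigzag_potential subr_le0; set n := Num.trunc r.
have h0 : 0 <= 2^-1 ^+ n :> R by rewrite exprn_ge0.
apply: (@le_trans _ _ (2^-1 ^+ n)); last lra.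
by apply: le_trans (msmall n); rewrite ler_wpM2r ?powR_ge0 // ler_nat step_le.
Qed.

Lemma truncn_node n i : (i <= m n)%N ->
  Num.trunc (n%:R + i%:R / (m n).+1%:R : R) = n.
Proof.
move=> im; apply: truncn_def; rewrite lerDl divr_ge0 //=.
by rewrite -[n.+1%:R]natr1 ltrD2l ltr_pdivrMr // mul1r ltr_nat.
Qed.

Lemma zigzag_node n i : (i <= m n)%N ->
  zigzag (n%:R + i%:R / (m n).+1%:R) = y n (odd i).
Proof.
move=> im; rewrite /zigzag /step truncn_node // [_ + _ - _]addrC addKr.
by rewrite mulrC divfK // natrK.
Qed.

(** Each of the [m n] oscillations of block [n] contributes at least [1 / m n],
    so a control of [f o zigzag] increases by 1 per block. *)
Lemma zigzag_uncontrolled (q : R) (f : E -> E) (H : R -> R) (M : R) :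
  (forall n, 1 <= (m n)%:R * rnorm (f (y n true) - f (y n false)) `^ q) ->
  (forall r, 0 <= r -> H r <= M) ->
  ~ (forall r s, 0 <= r -> r <= s ->
       rnorm (f (zigzag s) - f (zigzag r)) `^ q <= H s - H r).
Proof.
move=> mbig HM Hctl.
have Hnd r s : 0 <= r -> r <= s -> H r <= H s.
  by move=> r0 rs; rewrite -subr_ge0 (le_trans _ (Hctl _ _ r0 rs)) // powR_ge0.
pose node n i : R := n%:R + i%:R / (m n).+1%:R.
have node0 n i : 0 <= node n i by rewrite addr_ge0 // divr_ge0.
have gain n i : (i <= m n)%N ->
    i%:R * rnorm (f (y n true) - f (y n false)) `^ q <= H (node n i) - H n%:R.
  elim: i => [|i IH] im; first by rewrite /node !mul0r addr0 subrr.
  have node_le : node n i <= node n i.+1.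
    by rewrite lerD2l ler_wpM2r ?invr_ge0 // ler_nat.
  have := Hctl _ _ (node0 n i) node_le; rewrite !zigzag_node //; last exact: ltnW.
  have -> : rnorm (f (y n (odd i.+1)) - f (y n (odd i))) =
            rnorm (f (y n true) - f (y n false)).
    by rewrite /=; case: (odd i); rewrite //= rdistC.
  have := IH (ltnW im); rewrite -[i.+1%:R]natr1 mulrDl mul1r; lra.
have block n : H n%:R + 1 <= H n.+1%:R.
  have /le_trans Hle : 1 <= H (node n (m n)) - H n%:R.
    exact: le_trans (mbig n) (gain _ _ _).
  rewrite addrC -lerBrDr; apply: Hle; rewrite lerB // Hnd //.
  by rewrite /node -[n.+1%:R]natr1 lerD2l ler_pdivrMr // mul1r ler_nat.
have grow n : H 0 + n%:R <= H n%:R.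
  elim: n => [|n IH]; first by rewrite addr0.
  by apply: le_trans (block n); rewrite -[n.+1%:R]natr1 addrA lerD2r.
have MH : 0 <= M - H 0 by rewrite subr_ge0 HM.
have := le_trans (grow (Num.bound (M - H 0))) (HM _ (ler0n _ _)).
by rewrite -lerBrDl leNgt archi_boundP.
Qed.

End zigzag.

(** * Compressing the half-line into a bounded interval *)

Section clock.
Context {R : realType}.
Variables (a b : R).
Hypothesis ab : a < b.

(** An increasing bijection from [[a, b[] to the half-line of nonnegative reals,
    with inverse [unclock]. *)
Definition clock (t : R) : R := (b - t)^-1 - (b - a)^-1.

Definition unclock (r : R) : R := b - (r + (b - a)^-1)^-1.

Let ba0 : 0 < (b - a)^-1. Proof. by rewrite invr_gt0 subr_gt0. Qed.

Lemma clock_le s t : s <= t -> t < b -> clock s <= clock t.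
Proof.
move=> st tb; have sb := le_lt_trans st tb.
by rewrite lerD2r lef_pV2 ?posrE ?subr_gt0 // lerB.
Qed.

Lemma clock_ge0 t : a <= t -> t < b -> 0 <= clock t.
Proof. by move=> at_ tb; rewrite -(subrr (b - a)^-1) clock_le. Qed.

Lemma unclock_lt r : 0 <= r -> unclock r < b.
Proof. by move=> r0; rewrite ltrBlDr ltrDl invr_gt0 ltr_wpDl. Qed.

Lemma unclock_ge r : 0 <= r -> a <= unclock r.
Proof.
move=> r0; rewrite lerBrDr -lerBrDl -[leRHS]invrK.
by rewrite lef_pV2 ?posrE ?ltr_wpDl // lerDr.
Qed.

Lemma unclock_le r s : 0 <= r -> r <= s -> unclock r <= unclock s.
Proof.
move=> r0 rs; rewrite lerB // lef_pV2 ?posrE ?lerD2r ?ltr_wpDl //.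
exact: le_trans rs.
Qed.

Lemma unclockK r : clock (unclock r) = r.
Proof. by rewrite /clock /unclock subKr invrK addrK. Qed.

End clock.

(** * The necessity of the Hölder condition *)

Section necessity.
Context {R : realType} {k : scalar_kind} {E : normedModType (scalars R k)}.

(** At [b] the map takes one of the first two points of the zigzag, which lies at
    distance at most 1 from all the others; the control, nonpositive before [b],
    can therefore be completed by the value 1 at [b]. *)
Lemma zigzag_BV (a b p q : R) (f : E -> E) (y : nat -> bool -> E) (m : nat -> nat) :
  a < b -> 1 <= p -> 0 < q ->
  (forall n j b c, (n <= j)%N -> rnorm (y j c - y n b) <= 2^-1 ^+ n) ->
  (forall n, (m n)%:R * rnorm (y n true - y n false) `^ p <= 2^-1 ^+ n) ->
  (forall n, 1 <= (m n)%:R * rnorm (f (y n true) - f (y n false)) `^ q) ->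
  exists2 x : R -> E, BV p a b x & ~ BV q a b (comp_op f x).
Proof.
move=> ab p1 q0 yclose msmall mbig.
have p0 : 0 < p by apply: lt_le_trans p1.
pose x t := if t < b then zigzag y m (clock a b t) else y 0%N false.
exists x.
- apply/(BV_controlP _ (lt0r_neq0 p0) (ltW ab)).
  exists (fun t => if t < b then zigzag_potential y m p (clock a b t) else 1).
  move=> s t as_ st tb.
  rewrite /x; have [tltb|blet] := ltP t b.
    rewrite (le_lt_trans st tltb); apply: zigzag_control => //; last exact: clock_le.
    by apply: clock_ge0 => //; exact: le_lt_trans tltb.
  have [sb|bs] := ltP s b; last by rewrite !subrr rnorm0 powR0 // gt_eqF.
  have := yclose 0%N (Num.trunc (clock a b s)) false
    (odd (step m (clock a b s))) (leq0n _).
  rewrite expr0 rdistC => /(ler_powR_base (ltW p0) (rnorm_ge0 _)).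
  rewrite powR1 => /le_trans; apply.
  by rewrite lerDl oppr_ge0 zigzag_potential_le0 // clock_ge0.
- move=> /(BV_controlP _ (lt0r_neq0 q0) (ltW ab))[U xU].
  have Und t : a <= t -> t <= b -> U t <= U b.
    by move=> at_ tb; rewrite -subr_ge0 (le_trans _ (xU _ _ at_ tb (lexx b))) ?powR_ge0.
  apply: (@zigzag_uncontrolled _ _ _ y m q f (U \o unclock a b) (U b) mbig).
    by move=> r r0 /=; apply: Und; [exact: unclock_ge|exact/ltW/unclock_lt].
  move=> r s r0 rs; have s0 := le_trans r0 rs.
  have := xU _ _ (unclock_ge ab r0) (unclock_le ab r0 rs) (ltW (unclock_lt ab s0)).
  by rewrite /comp_op /x !unclock_lt // !unclockK.
Qed.

End necessity.

Theorem theorem4 (R : realType) (k : scalar_kind)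
  (E : normedModType (scalars R k)) (a b p q : R) (f : E -> E)
  (hab : a < b) (hp : 1 <= p) (hpq : p <= q) :
  (forall x : R -> E, BV p a b x -> BV q a b (comp_op f x)) <->
  hoelder_on_precompact (p / q) f.
Proof.
have p0 : 0 < p by apply: lt_le_trans hp.
have q0 : 0 < q by apply: lt_le_trans hpq.
split=> [fBV K Kc|fH x]; last exact: comp_op_BV (ltW hab) fH.
apply: contrapT => /(oscillation_of_not_hoelder p0 q0 Kc).
move=> /(fast_oscillation hp Kc)[y [m [yclose msmall mbig]]].
have [x xBV xnBV] := zigzag_BV hab hp q0 yclose msmall mbig.
exact: xnBV (fBV x xBV).
Qed.
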